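(* Let $\psi:\mathbb{R}_+\to\mathbb{R}_+$ be a convex admissible function and let $f:\mathbb{R}^n\to\mathbb{R}\cup\{+\infty\}$ be a proper lower semicontinuous convex function. Let $\bar x$ be a minimizer of $f$ and suppose that there exist $\kappa,r\in(0,+\infty)$ such that $$\kappa\|h\|^2\,\eta_\psi(x,v)(h)\le\langle z,h\rangle$$ for all $(x,v)\in{\rm gph}(\partial f)$ and $h\in\mathbb{R}^n$ with $(x,v,h)\in B(\bar x,r)\times B(0,r)\times B(0,r)$ and all $z\in\partial^2f(x,v)(h)$. Then $f$ has $\varphi$-SLWP at $\bar x$ with $\varphi(t):=\int_0^t\psi(s)\,ds$.
   Context: $\mathbb{R}^n$ carries the Euclidean norm; $B(x,r)$ and $B[x,r]$ are the open and closed balls; $\mathbb{R}_+=[0,+\infty)$; $d(x,A)=\inf_{a\in A}\|x-a\|$, $d(x,\emptyset)=+\infty$; for a nondecreasing $g$ on $\mathbb{R}_+$, $g(+\infty):=\lim_{t\to+\infty}g(t)\in[0,+\infty]$. Admissible function: a nondecreasing $\psi:\mathbb{R}_+\to\mathbb{R}_+$ with $\psi(0)=0$ such that $\psi(t)\to0$ implies $t\to0$. $\psi'_+$ is the right derivative of $\psi$. $\partial f$ is the subdifferential of convex analysis: $\partial f(x)=\{v:\langle v,y-x\rangle\le f(y)-f(x)\ \forall y\}$ for $f(x)<+\infty$, and $\emptyset$ otherwise (it coincides with the limiting subdifferential for convex $f$). ${\rm gph}(\partial f)=\{(x,v):v\in\partial f(x)\}$, $(\partial f)^{-1}(v)=\{x:v\in\partial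 f(x)\}$. Limiting (Mordukhovich) normal cone of a set $A\subset\mathbb{R}^m$ at $a\in A$: $\tilde N(A,a)$ is the set of limits of sequences $a_k^*$ with $a_k^*\in\hat N(A,a_k)$, $a_k\in A$, $a_k\to a$, where $\hat N(A,a_k)=\{a^*:\limsup_{y\to a_k,\,y\in A,\,y\ne a_k}\langle a^*,y-a_k\rangle/\|y-a_k\|\le0\}$. Second subdifferential: for $(x,v)\in{\rm gph}(\partial f)$ and $h\in\mathbb{R}^n$, $\partial^2f(x,v)(h)=\{z\in\mathbb{R}^n:(z,-h)\in\tilde N({\rm gph}(\partial f),(x,v))\}$. $\eta_\psi(x,v)(h):=\psi'_+\big(d(x,(\partial f)^{-1}(v-h))\big)$ for $(x,v)\in{\rm gph}(\partial f)$, $h\in\mathbb{R}^n$. $\varphi$-SLWP of $f$ at $\bar x$ (with $f(\bar x)<+\infty$): writing $f_u(x):=f(x)-\langle u,x\rangle$, there exist $\delta,r',\tau',\kappa'\in(0,+\infty)$ such that for every $u\in B(0,\delta)$ there is $x_u\in B[\bar x,r']$, with $x_0=\bar x$, satisfying $\varphi(\kappa'\|x-x_u\|)\le\tau'(f_u(x)-f_u(x_u))$ for all $x\in B[\bar x,r']$. *)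

(* Defs.v *)
From HB Require Import structures.
From mathcomp Require Import all_boot all_order all_algebra.
From mathcomp Require Import all_classical all_reals all_analysis.

Set Implicit Arguments.
Unset Strict Implicit.
Unset Printing Implicit Defensive.

Import Order.TTheory GRing.Theory Num.Theory.
Import numFieldNormedType.Exports.

Local Open Scope classical_set_scope.
Local Open Scope ring_scope.

(* The library's norm on row vectors is the sup norm, hence [enorm]. Limits and
   neighbourhoods in ['rV[R]_n] are the library's: both norms induce the same
   topology. *)
Definition dot (R : realType) (n : nat) (x y : 'rV[R]_n) : R :=
  \sum_(i < n) x 0 i * y 0 i.

Definition enorm (R : realType) (n : nat) (x : 'rV[R]_n) : R :=
  Num.sqrt (dot x x).

Definition eball (R : realType) (n : nat) (x : 'rV[R]_n) (r : R) :
    set 'rV[R]_n :=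
  [set y | enorm (y - x) < r].

Definition ecball (R : realType) (n : nat) (x : 'rV[R]_n) (r : R) :
    set 'rV[R]_n :=
  [set y | enorm (y - x) <= r].

(* The infimum of the empty set is [+oo] in [\bar R]. *)
Definition dist_set (R : realType) (n : nat) (x : 'rV[R]_n)
    (A : set 'rV[R]_n) : \bar R :=
  ereal_inf [set (enorm (x - a))%:E | a in A].

(* Functions on [0, +oo) are represented by functions on [R]; their values at
   negative arguments are never used. *)
Definition admissible (R : realType) (psi : R -> R) : Prop :=
  [/\ forall t, 0 <= t -> 0 <= psi t,
      forall s t, 0 <= s -> s <= t -> psi s <= psi t,
      psi 0 = 0 &
      forall t : nat -> R, (forall k, 0 <= t k) ->
        (psi \o t) @ \oo --> (0 : R) -> t @ \oo --> (0 : R)].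

Definition convex_on_nonneg (R : realType) (psi : R -> R) : Prop :=
  convex_function (E := R^o) `[0, +oo[%classic psi.

Definition rderiv (R : realType) (psi : R -> R) (t : R) : R :=
  lim (h^-1 * (psi (t + h) - psi t) @[h --> 0^'+]).

(* Extension of a nondecreasing [g] on [0, +oo) to [0, +oo]; the value at [-oo]
   is junk. *)
Definition extend_pinfty (R : realType) (g : R -> R) (t : \bar R) : \bar R :=
  match t with
  | EFin s => (g s)%:E
  | EPInf => lim ((g s)%:E @[s --> +oo])
  | ENInf => 0%E
  end.

Definition proper_fun (R : realType) (n : nat) (f : 'rV[R]_n -> \bar R) : Prop :=
  (forall x, (-oo < f x)%E) /\ exists x, (f x < +oo)%E.

(* No [+oo - oo] occurs for [f] avoiding [-oo], and [0 * +oo = 0]. *)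
Definition convex_efun (R : realType) (n : nat) (f : 'rV[R]_n -> \bar R) : Prop :=
  forall (x y : 'rV[R]_n) (t : R), 0 <= t -> t <= 1 ->
    (f (t *: x + (1 - t) *: y)%R <= t%:E * f x + (1 - t)%:E * f y)%E.

Definition subdiff (R : realType) (n : nat) (f : 'rV[R]_n -> \bar R)
    (x : 'rV[R]_n) : set 'rV[R]_n :=
  [set v | (f x < +oo)%E /\ forall y, ((dot v (y - x))%:E <= f y - f x)%E].

Definition subdiff_inv (R : realType) (n : nat) (f : 'rV[R]_n -> \bar R)
    (v : 'rV[R]_n) : set 'rV[R]_n :=
  [set x | subdiff f x v].

Definition gph_subdiff (R : realType) (n : nat) (f : 'rV[R]_n -> \bar R) :
    set 'rV[R]_(n + n) :=
  [set p | subdiff f (lsubmx p) (rsubmx p)].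

(* At an isolated point of [A] the filter contains the empty set, so the limsup
   is [-oo] and every vector is a normal. *)
Definition frechet_normal (R : realType) (m : nat) (A : set 'rV[R]_m)
    (a : 'rV[R]_m) : set 'rV[R]_m :=
  [set a' | (limf_esup (fun y : 'rV[R]_m => (dot a' (y - a) / enorm (y - a))%:E)
               (within [set y | A y /\ y != a] (nbhs a)) <= 0)%E].

Definition limiting_normal (R : realType) (m : nat) (A : set 'rV[R]_m)
    (a : 'rV[R]_m) : set 'rV[R]_m :=
  [set a' | exists (ak ak' : nat -> 'rV[R]_m),
     [/\ forall k, A (ak k),
         forall k, frechet_normal A (ak k) (ak' k),
         ak @ \oo --> a &
         ak' @ \oo --> a']].

Definition second_subdiff (R : realType) (n : nat) (f : 'rV[R]_n -> \bar R)
    (x v h : 'rV[R]_n) : set 'rV[R]_n :=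
  [set z | limiting_normal (gph_subdiff f) (row_mx x v) (row_mx z (- h))].

Definition eta_psi (R : realType) (n : nat) (psi : R -> R) (f : 'rV[R]_n -> \bar R)
    (x v h : 'rV[R]_n) : \bar R :=
  extend_pinfty (rderiv psi) (dist_set x (subdiff_inv f (v - h))).

Definition tilt (R : realType) (n : nat) (f : 'rV[R]_n -> \bar R)
    (u x : 'rV[R]_n) : \bar R :=
  (f x - (dot u x)%:E)%E.

(* [f (xs u) < +oo] is automatic: taking [x := xbar], [+oo - oo = -oo] makes the
   inequality fail when [f (xs u) = +oo]. *)
Definition SLWP (R : realType) (n : nat) (phi : R -> R)
    (f : 'rV[R]_n -> \bar R) (xbar : 'rV[R]_n) : Prop :=
  (f xbar < +oo)%E /\
  exists delta r' tau' kappa' : R,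
    [/\ 0 < delta, 0 < r', 0 < tau', 0 < kappa' &
      exists xs : 'rV[R]_n -> 'rV[R]_n,
        xs 0 = xbar /\
        forall u, eball 0 delta u ->
          ecball xbar r' (xs u) /\
          forall x, ecball xbar r' x ->
            ((phi (kappa' * enorm (x - xs u)))%:E
               <= tau'%:E * (tilt f u x - tilt f u (xs u)))%E].

(* Main.v *)
Require Import Defs.
From HB Require Import structures.
From mathcomp Require Import all_boot all_order all_algebra.
From mathcomp Require Import all_classical all_reals all_analysis.
From mathcomp Require Import ring lra.
Import Order.TTheory GRing.Theory Num.Theory.
Import numFieldNormedType.Exports.
Local Open Scope classical_set_scope.
Local Open Scope ring_scope.

(* Write T for the subdifferential of f. Starting from (x0,v0) in gph T and a
   target u close to v0, minimise |v - u| + lam |x - x0| (with the second norm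
   smoothed) over the closed set gph T. If the minimiser (x,v) has v <> u, then
   (z, -(v - u)), with |z| <= lam |v - u|, is a normal to gph T at (x,v), so the
   hypothesis with h = v - u forces kappa psi'_+(d(x, T^-1 u)) <= lam. As
   psi(t)/t <= psi'_+(s) for s >= t, the choice lam < kappa psi(t)/t gives
   d(x, T^-1 u) < t; hence |v0 - u| < kappa psi(t) yields a point of T^-1 u at
   distance < 2t from x0.

   Starting from (xbar,0) this provides x_u. For the growth of f_u at x, put
   D = |x - x_u|, e = (x - x_u)/D, s = kappa psi(D/4)/2: there is x' in
   T^-1 (u + s e) with |x' - x_u| < D/2, and adding the subgradient inequalities
   at x' and at x_u gives
     f_u(x) - f_u(x_u) >= s <e, x - x'> >= s D/2 = kappa psi(D/4) D/4,
   which dominates kappa phi(D/4) because psi is nondecreasing. *)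

(** * Euclidean geometry of row vectors, minimisation on closed sets, Fréchet normals *)

Section Euclidean.
Set Implicit Arguments.
Unset Strict Implicit.
Unset Printing Implicit Defensive.
Context {R : realType}.

Lemma dotC n (x y : 'rV[R]_n) : dot x y = dot y x.
Proof. by apply: eq_bigr => i _; rewrite mulrC. Qed.

Lemma dotDr n (x y z : 'rV[R]_n) : dot x (y + z) = dot x y + dot x z.
Proof. by rewrite -big_split; apply: eq_bigr => i _; rewrite mxE mulrDr. Qed.

Lemma dotZr n a (x y : 'rV[R]_n) : dot x (a *: y) = a * dot x y.
Proof.
by rewrite /dot mulr_sumr; apply: eq_bigr => i _; rewrite mxE mulrCA.
Qed.

Lemma dotNr n (x y : 'rV[R]_n) : dot x (- y) = - dot x y.
Proof. by rewrite -scaleN1r dotZr mulN1r. Qed.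

Lemma dotDl n (x y z : 'rV[R]_n) : dot (x + y) z = dot x z + dot y z.
Proof. by rewrite dotC dotDr !(dotC z). Qed.

Lemma dotZl n a (x y : 'rV[R]_n) : dot (a *: x) y = a * dot x y.
Proof. by rewrite dotC dotZr dotC. Qed.

Lemma dotNl n (x y : 'rV[R]_n) : dot (- x) y = - dot x y.
Proof. by rewrite dotC dotNr dotC. Qed.

Definition dotE := (dotDr, dotDl, dotNr, dotNl, dotZr, dotZl).

Lemma dot_row_mx n1 n2 (a : 'rV[R]_n1) (b : 'rV[R]_n2) (p : 'rV[R]_(n1 + n2)) :
  dot (row_mx a b) p = dot a (lsubmx p) + dot b (rsubmx p).
Proof.
rewrite /dot big_split_ord; congr +%R; apply: eq_bigr => i _.
  by rewrite row_mxEl !mxE.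
by rewrite row_mxEr !mxE.
Qed.

Lemma dot_ge0 n (x : 'rV[R]_n) : 0 <= dot x x.
Proof. by apply: sumr_ge0 => i _; rewrite -expr2 sqr_ge0. Qed.

Lemma enorm_ge0 n (x : 'rV[R]_n) : 0 <= enorm x.
Proof. exact: sqrtr_ge0. Qed.

Lemma sqr_enorm n (x : 'rV[R]_n) : enorm x ^+ 2 = dot x x.
Proof. by rewrite sqr_sqrtr // dot_ge0. Qed.

Lemma enorm0 n : enorm (0 : 'rV[R]_n) = 0.
Proof. by rewrite /enorm -(scale0r 0) dotZl mul0r sqrtr0. Qed.

Lemma enormN n (x : 'rV[R]_n) : enorm (- x) = enorm x.
Proof. by rewrite /enorm dotNl dotNr opprK. Qed.

Lemma enormZ n a (x : 'rV[R]_n) : enorm (a *: x) = `|a| * enorm x.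
Proof.
by rewrite /enorm dotZl dotZr mulrA -expr2 sqrtrM ?sqr_ge0 // sqrtr_sqr.
Qed.

Lemma coord_le_enorm n (x : 'rV[R]_n) i : `|x 0 i| <= enorm x.
Proof.
rewrite -sqrtr_sqr; apply: ler_wsqrtr.
rewrite /dot (bigD1 i) //= -expr2 lerDl.
by apply: sumr_ge0 => j _; rewrite -expr2 sqr_ge0.
Qed.

Lemma enorm_eq0 n (x : 'rV[R]_n) : enorm x = 0 -> x = 0.
Proof.
move=> x0; apply/rowP => i; rewrite mxE; apply/normr0_eq0/le_anti.
by rewrite normr_ge0 -x0 coord_le_enorm.
Qed.

Lemma enorm_gt0 n (x : 'rV[R]_n) : x != 0 -> 0 < enorm x.
Proof.
by move=> x0; rewrite lt_def enorm_ge0 andbT; apply: contra_neq x0 => /enorm_eq0.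
Qed.

(** Cauchy-Schwarz, from expanding the square of [enorm y *: x - enorm x *: y]. *)
Lemma dot_le_enorm n (x y : 'rV[R]_n) : dot x y <= enorm x * enorm y.
Proof.
have [->|/enorm_gt0 x0] := eqVneq x 0.
  by rewrite -(scale0r 0) dotZl mul0r mulr_ge0 ?enorm_ge0.
have [->|/enorm_gt0 y0] := eqVneq y 0.
  by rewrite -(scale0r 0) dotZr mul0r mulr_ge0 ?enorm_ge0.
have := dot_ge0 (enorm y *: x - enorm x *: y).
rewrite !dotE -!sqr_enorm (dotC y x).
have xy0 := mulr_gt0 x0 y0.
by move=> pos; rewrite -(ler_pM2l xy0); lra.
Qed.

Lemma sqr_enormD n (x y : 'rV[R]_n) :
  enorm (x + y) ^+ 2 = dot x x + 2 * dot x y + dot y y.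
Proof. by rewrite sqr_enorm !dotE (dotC y x); ring. Qed.

Lemma enormD n (x y : 'rV[R]_n) : enorm (x + y) <= enorm x + enorm y.
Proof.
rewrite -(@ler_pXn2r _ 2) ?nnegrE ?addr_ge0 ?enorm_ge0 //.
rewrite sqrrD sqr_enormD !sqr_enorm.
by have := dot_le_enorm x y; rewrite -mulr_natr; lra.
Qed.

Lemma enorm_dist n (x y : 'rV[R]_n) : enorm (x - y) = enorm (y - x).
Proof. by rewrite -enormN opprB. Qed.

Lemma norm_le_enorm n (x : 'rV[R]_n) : `|x| <= enorm x.
Proof.
rewrite /Num.Def.normr /= mx_normrE; apply/bigmax_leP; split=> [|[i j] _ /=].
  exact: enorm_ge0.
by rewrite ord1 coord_le_enorm.
Qed.

Lemma continuous_dot (T : topologicalType) n (F G : T -> 'rV[R]_n) :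
  (forall i, continuous (fun y => F y 0 i)) ->
  (forall i, continuous (fun y => G y 0 i)) ->
  continuous (fun y => dot (F y) (G y)).
Proof.
move=> Fc Gc x; apply: cvg_big => [|i _]; first exact: add_continuous.
exact: continuousM (Fc i x) (Gc i x).
Qed.

Lemma continuous_coordB (T : topologicalType) n (F G : T -> 'rV[R]_n) i :
  continuous (fun y => F y 0 i) -> continuous (fun y => G y 0 i) ->
  continuous (fun y => (F y - G y) 0 i).
Proof.
move=> Fc Gc; under eq_fun do rewrite !mxE.
by move=> y; apply: continuousB; [exact: Fc|exact: Gc].
Qed.

Lemma continuous_enormB (T : topologicalType) n (F : T -> 'rV[R]_n) a :
  (forall i, continuous (fun y => F y 0 i)) ->
  continuous (fun y => enorm (F y - a)).
Proof.
move=> Fc x.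
apply: (@continuous_comp _ _ _ (fun y => dot (F y - a) (F y - a)) Num.sqrt);
  last exact: sqrt_continuous.
by apply: continuous_dot => i; apply: continuous_coordB => // y;
  exact: cst_continuous.
Qed.

Lemma continuous_coord_lsubmx n1 n2 i :
  continuous (fun p : 'rV[R]_(n1 + n2) => lsubmx p 0 i).
Proof. by under eq_fun do rewrite mxE; exact: coord_continuous. Qed.

Lemma continuous_coord_rsubmx n1 n2 i :
  continuous (fun p : 'rV[R]_(n1 + n2) => rsubmx p 0 i).
Proof. by under eq_fun do rewrite mxE; exact: coord_continuous. Qed.

(** The sublevel set of [p0] in [A] is closed and bounded, hence compact, so [F] attains its minimum
    there; points outside it have larger values. *)
Lemma closed_argmin m (A : set 'rV[R]_m) (F : 'rV[R]_m -> R) p0 :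
  closed A -> continuous F -> A p0 ->
  (exists M, forall p, F p <= F p0 -> `|p| <= M) ->
  exists2 p, A p & forall q, A q -> F p <= F q.
Proof.
move=> Acl Fc Ap0 [M Mge].
pose B := A `&` [set p | F p <= F p0].
have Bcpt : compact B.
  apply: bounded_closed_compact.
    exists M; split; first exact: num_real.
    by move=> N MN p [_ /Mge pM]; exact: le_trans pM (ltW MN).
  apply: closedI => //.
  by apply: (@preimage_closed _ _ F [set t | t <= F p0]) => [? _|]; [exact: Fc|exact: closed_le].
have [||p /set_mem[Ap pp0] pmin] := @EVT_min_rV R m F B _ Bcpt _.
- by exists p0; split => /=.
- exact: continuous_subspaceT.
exists p => // q Aq.
have [qp0|/ltW p0q] := leP (F q) (F p0); first exact/pmin/mem_set.
exact: le_trans pp0 p0q.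
Qed.

(** Proximal normals are Fréchet normals: the quotient in the limsup is at most [K * enorm (y - a)],
    which tends to 0. *)
Lemma frechet_normal_quadratic m (A : set 'rV[R]_m) (a w : 'rV[R]_m) (K : R) :
  (forall y, A y -> dot w (y - a) <= K * enorm (y - a) ^+ 2) ->
  frechet_normal A a w.
Proof.
move=> Kle; rewrite /frechet_normal /= limf_esupE; apply/lee_addgt0Pr => e e0.
rewrite add0e; apply: ge_ereal_inf.
pose V := [set y | [/\ A y, y != a & K * enorm (y - a) < e]].
exists (ereal_sup [set (dot w (y - a) / enorm (y - a))%:E | y in V]).
  exists V => //.
  have : \forall y \near a, K * enorm (y - a) < e.
    have ec : continuous (fun y : 'rV[R]_m => enorm (y - a)).
      by apply: continuous_enormB => i; exact: coord_continuous.
    have Kc := @cvgMr _ _ _ (nbhs_filter a) _ K _ (ec a).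
    have /(_ e) := @cvgr_lt _ _ _ (nbhs_filter a) _ _ Kc.
    by rewrite subrr enorm0 mulr0; apply.
  by apply: filterS => y ye [Ay ya]; split.
apply: ge_ereal_sup => _ [y [Ay ya ye] <-]; rewrite lee_fin.
have y0 : 0 < enorm (y - a) by rewrite enorm_gt0 // subr_eq0.
rewrite ler_pdivrMr //; apply: (le_trans (Kle _ Ay)).
by rewrite expr2 mulrA ler_pM2r // ltW.
Qed.

End Euclidean.

(** * Difference quotients, right derivative and integral of a convex admissible function *)

Section ConvexSlopes.
Set Implicit Arguments.
Unset Strict Implicit.
Unset Printing Implicit Defensive.
Context {R : realType} (psi : R -> R).
Hypotheses (psi_adm : admissible psi) (psi_convex : convex_on_nonneg psi).

Let quot (s h : R) := h^-1 * (psi (s + h) - psi s).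

Lemma convex_on_nonnegP (x y t : R) : 0 <= x -> 0 <= y -> 0 <= t -> t <= 1 ->
  psi (t * x + (1 - t) * y) <= t * psi x + (1 - t) * psi y.
Proof.
move=> x0 y0 t0 t1.
have := psi_convex (Itv01 t0 t1) (x := x) (y := y).
rewrite !inE /= !in_itv /= !andbT => /(_ x0 y0).
by rewrite /conv /=.
Qed.

(** The point [s + h] is the convex combination of [s + h'] and [s] with weight [h / h']. *)
Lemma quot_homo s h h' : 0 <= s -> 0 < h -> h <= h' -> quot s h <= quot s h'.
Proof.
move=> s0 h0 hh'; have h'0 := lt_le_trans h0 hh'.
have t0 : 0 <= h / h' by rewrite divr_ge0 // ltW.
have t1 : h / h' <= 1 by rewrite ler_pdivrMr ?mul1r.
have sh'0 : 0 <= s + h' by rewrite addr_ge0 // ltW.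
have := convex_on_nonnegP sh'0 s0 t0 t1.
have -> : h / h' * (s + h') + (1 - h / h') * s = s + h.
  by field; rewrite gt_eqF.
move=> le_sh; rewrite /quot mulrC ler_pdivrMr // mulrAC.
have -> : h'^-1 * h * (psi (s + h') - psi s)
          = h / h' * psi (s + h') + (1 - h / h') * psi s - psi s by ring.
lra.
Qed.

(** By [quot_homo], the slope over [[s, s']] is at most the slope over [[s, s' + h]]; clearing
    denominators turns this into the claim. *)
Lemma three_slopes s s' h : 0 <= s -> s < s' -> 0 < h ->
  (psi s' - psi s) / (s' - s) <= quot s' h.
Proof.
move=> s0 ss' h0; have d0 : 0 < s' - s by rewrite subr_gt0.
have := @quot_homo s (s' - s) (s' - s + h) s0 d0.
rewrite lerDl ltW // => /(_ isT).
rewrite /quot subrKC addrA subrKC => le1.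
have dh0 : 0 < s' - s + h by rewrite addr_gt0.
move: le1; rewrite ![_^-1 * _]mulrC ler_pdivrMr // mulrAC ler_pdivlMr //.
rewrite ler_pdivrMr // mulrAC ler_pdivlMr //.
lra.
Qed.

(** The quotients are monotone in [h] and bounded below by 0, so the [lim] in [rderiv] is an actual
    limit and equals their infimum. *)
Lemma rderiv_inf s : 0 <= s ->
  rderiv psi s = inf [set quot s h | h in `]0, +oo[].
Proof.
move=> s0; have [_ psi_homo _ _] := psi_adm.
apply: cvg_lim; first exact: Rhausdorff.
apply: (@nondecreasing_at_right_cvgr _ (quot s) 0 +oo%O) => //.
  move=> h h'; rewrite !in_itv /= !andbT => h0 _; exact: quot_homo.
exists 0 => y [h /=]; rewrite in_itv /= andbT => h0 <-.
apply: mulr_ge0; first by rewrite invr_ge0 ltW.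
by rewrite subr_ge0 psi_homo // lerDl ltW.
Qed.

Lemma rderiv_ge s c : 0 <= s -> (forall h, 0 < h -> c <= quot s h) ->
  c <= rderiv psi s.
Proof.
move=> s0 cle; rewrite rderiv_inf //; apply: lb_le_inf.
  by exists (quot s 1); exists 1 => //=; rewrite in_itv /= ltr01.
by move=> y [h /=]; rewrite in_itv /= andbT => h0 <-; exact: cle.
Qed.

Lemma rderiv_le s h : 0 <= s -> 0 < h -> rderiv psi s <= quot s h.
Proof.
move=> s0 h0; rewrite rderiv_inf //; apply: ge_inf.
  have [_ psi_homo _ _] := psi_adm.
  exists 0 => y [k /=]; rewrite in_itv /= andbT => k0 <-.
  apply: mulr_ge0; first by rewrite invr_ge0 ltW.
  by rewrite subr_ge0 psi_homo // lerDl ltW.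
by exists h => //=; rewrite in_itv /= h0.
Qed.

Lemma rderiv_homo s s' : 0 <= s -> s <= s' -> rderiv psi s <= rderiv psi s'.
Proof.
move=> s0; rewrite le_eqVlt => /predU1P[->//|ss'].
apply: rderiv_ge => [|h h0]; first exact: le_trans s0 (ltW ss').
apply: le_trans (three_slopes s0 ss' h0).
have := @rderiv_le s (s' - s) s0.
by rewrite /quot subrKC mulrC subr_gt0; exact.
Qed.

(** As [psi 0 = 0], the ratio [psi t / t] is the slope of the chord over [[0, t]]. *)
Lemma slope_le_rderiv t s : 0 < t -> t <= s -> psi t / t <= rderiv psi s.
Proof.
move=> t0 ts; apply: le_trans (rderiv_homo (ltW t0) ts).
apply: rderiv_ge => [|h h0]; first exact: ltW.
have [_ _ psi0 _] := psi_adm.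
by have := three_slopes (lexx 0) t0 h0; rewrite psi0 !subr0.
Qed.

(** The value [+oo] of [d] must be covered: it is the distance to an empty inverse image. *)
Lemma slope_le_extend_pinfty t (d : \bar R) : 0 < t -> (t%:E <= d)%E ->
  ((psi t / t)%:E <= extend_pinfty (rderiv psi) d)%E.
Proof.
move=> t0; case: d => [s| |] //=; first by rewrite !lee_fin; exact: slope_le_rderiv.
move=> _.
(* Truncating at 0 makes the function monotone on the whole line, so its limit at [+oo] exists; near
   [+oo] nothing changes. *)
pose g s := (rderiv psi (Num.max 0 s))%:E.
have g_homo : {homo g : x y / x <= y >-> (x <= y)%E}.
  move=> x y xy; rewrite lee_fin; apply: rderiv_homo; first by rewrite le_max lexx.
  by rewrite ge_max le_max lexx /= le_max xy orbT.
have gE : \forall s \near +oo, g s = (rderiv psi s)%:E.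
  near=> s; rewrite /g max_r //; near: s; exact: nbhs_pinfty_ge.
have g_cvg : cvg ((rderiv psi s)%:E @[s --> +oo]).
  apply: cvgP; apply: cvg_trans (nondecreasing_cvge g_homo).
  exact: near_eq_cvg.
apply: lime_ge => //; near=> s; rewrite lee_fin; apply: slope_le_rderiv => //.
Unshelve. all: by end_near.
Qed.

(** If [psi t = 0], admissibility applied to the constant sequence [t] forces [t = 0]. *)
Lemma psi_gt0 t : 0 < t -> 0 < psi t.
Proof.
move=> t0; have [psi_ge0 _ _ adm] := psi_adm.
rewrite lt_def psi_ge0 ?ltW // andbT; apply/eqP => psit.
have := adm (fun=> t) (fun=> ltW t0).
rewrite /comp /= psit => /(_ (cvg_cst _)) tc.
have tE : t = 0 by apply: (cvg_unique _ _ tc) => //; exact: cvg_cst.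
by rewrite tE ltxx in t0.
Qed.

Lemma psi_le_mul t : 0 <= t -> t <= 1 -> psi t <= t * psi 1.
Proof.
move=> t0 t1; have [_ _ psi0 _] := psi_adm.
by have := convex_on_nonnegP ler01 (lexx 0) t0 t1; rewrite psi0 !mulr0 mulr1 !addr0.
Qed.

Lemma Rintegral_le_mul t : 0 <= t ->
  \int[lebesgue_measure]_(s in `[0, t]) psi s <= t * psi t.
Proof.
move=> t0; have [psi_ge0 psi_homo _ _] := psi_adm.
(* This extension is nondecreasing on the whole line, hence measurable. *)
pose g s := psi (Num.max 0 s).
have g_homo : {homo g : x y / x <= y}.
  move=> x y xy; apply: psi_homo; first by rewrite le_max lexx.
  by rewrite ge_max le_max lexx /= le_max xy orbT.
have it : (\int[lebesgue_measure]_(s in `[0%R, t]) (psi s)%:E <= (t * psi t)%:E)%E.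
  have -> : (\int[lebesgue_measure]_(s in `[0%R, t]) (psi s)%:E)%E
            = (\int[lebesgue_measure]_(s in `[0%R, t]) (g s)%:E)%E.
    apply: eq_integral => s; rewrite inE /= in_itv /= => /andP[s0 _].
    by rewrite /g max_r.
  apply: (@le_trans _ _ (\int[lebesgue_measure]_(s in `[0%R, t]) (psi t)%:E)%E).
    apply: ge0_le_integral => //.
    - by move=> s _; rewrite lee_fin psi_ge0 // le_max lexx.
    - apply/measurable_realfun.measurable_EFinP; exact: measurable_realfun.nondecreasing_measurable.
    - move=> s /=; rewrite in_itv /= => /andP[s0 st]; rewrite lee_fin /g max_r //.
      exact: psi_homo.
  rewrite integral_cst //= lebesgue_measure_itv /= lte_fin.
  case: ltP => [_|t0']; first by rewrite -EFinB subr0 -EFinM mulrC.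
  by rewrite mule0 lee_fin mulr_ge0 // psi_ge0.
(* The bound [it] rules out [+oo]; at [-oo] the real integral takes the default value 0. *)
rewrite /Rintegral; case: (integral _ _ _) it => [r| |] //=.
  by rewrite mulr_ge0 // psi_ge0.
Qed.

End ConvexSlopes.

(** * Penalised minimisation over the graph of the subdifferential and solvability near a given
    pair *)

Section Regularity.
Set Implicit Arguments.
Unset Strict Implicit.
Unset Printing Implicit Defensive.
Context {R : realType}.

Lemma continuous_lsubmx n1 n2 :
  continuous (fun p : 'rV[R]_(n1 + n2) => lsubmx p).
Proof.
move=> p U /nbhs_ballP[e e0 eU].
apply: (@filterS _ _ (nbhs_filter p) (ball p e)); last exact: nbhsx_ballx.
by move=> q [_ pq]; apply: eU; split=> // i j; rewrite !mxE; exact: pq.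
Qed.

(* [|v - u| + lam |x - x0|], made differentiable away from [v = u] by [eps]. *)
Definition penalty n (x0 u : 'rV[R]_n) (lam eps : R) (p : 'rV[R]_(n + n)) :=
  enorm (rsubmx p - u)
  + lam * Num.sqrt (enorm (lsubmx p - x0) ^+ 2 + eps ^+ 2).

Lemma continuous_penalty n (x0 u : 'rV[R]_n) lam eps :
  continuous (penalty x0 u lam eps).
Proof.
have lc : continuous (fun p : 'rV[R]_(n + n) => enorm (lsubmx p - x0)).
  by apply: continuous_enormB => i; exact: continuous_coord_lsubmx.
have rc : continuous (fun p : 'rV[R]_(n + n) => enorm (rsubmx p - u)).
  by apply: continuous_enormB => i; exact: continuous_coord_rsubmx.
move=> p; apply: (continuousD (rc p)).
apply: (@cvgMr _ _ _ (nbhs_filter p)).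
apply: (@continuous_comp _ _ _
  (fun q : 'rV[R]_(n + n) => enorm (lsubmx q - x0) ^+ 2 + eps ^+ 2) Num.sqrt);
  last exact: sqrt_continuous.
apply: continuousD; last exact: cst_continuous.
exact: continuousM (lc p) (lc p).
Qed.

(** Coercivity: the first term of the penalty controls [rsubmx p], and the second, divided by [lam],
    controls [lsubmx p]. Sublevel sets are thus bounded, as [closed_argmin] requires. *)
Lemma norm_le_penalty n (x0 u : 'rV[R]_n) lam eps p : 0 < lam ->
  `|p| <= enorm u + enorm x0 + penalty x0 u lam eps p
          + lam^-1 * penalty x0 u lam eps p.
Proof.
move=> lam0; set F := penalty _ _ _ _ _.
have le_sqrt : enorm (lsubmx p - x0)
    <= Num.sqrt (enorm (lsubmx p - x0) ^+ 2 + eps ^+ 2).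
  rewrite -[leLHS]ger0_norm ?enorm_ge0 // -sqrtr_sqr ler_wsqrtr //.
  by rewrite lerDl sqr_ge0.
have l_ge0 := enorm_ge0 (lsubmx p - x0).
have r_ge0 := enorm_ge0 (rsubmx p - u).
have le_r : enorm (rsubmx p - u) <= F.
  by rewrite lerDl; apply: mulr_ge0; rewrite ?sqrtr_ge0 // ltW.
have le_l : enorm (lsubmx p - x0) <= lam^-1 * F.
  rewrite ler_pdivlMl //; apply: le_trans (ler_wpM2l (ltW lam0) le_sqrt) _.
  by rewrite lerDr.
have le_x : enorm (lsubmx p) <= enorm (lsubmx p - x0) + enorm x0.
  by rewrite -[in leLHS](subrK x0 (lsubmx p)) enormD.
have le_v : enorm (rsubmx p) <= enorm (rsubmx p - u) + enorm u.
  by rewrite -[in leLHS](subrK u (rsubmx p)) enormD.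
have le_p : enorm p <= enorm (lsubmx p) + enorm (rsubmx p).
  rewrite -(@ler_pXn2r _ 2) ?nnegrE ?addr_ge0 ?enorm_ge0 // sqrrD !sqr_enorm.
  rewrite -[X in dot X _]hsubmxK dot_row_mx.
  by rewrite addrAC lerDl mulrn_wge0 // mulr_ge0 ?enorm_ge0.
have := norm_le_enorm p; lra.
Qed.

(** Fermat's rule: the normal is the negative gradient of the penalty at [p], scaled by
    [enorm (rsubmx p - u)]. Instead of differentiating, the proof derives a quadratic bound from
    minimality. *)
Lemma penalty_normal n (A : set 'rV[R]_(n + n)) (x0 u : 'rV[R]_n) lam eps b p :
  0 <= lam -> 0 < eps -> b = Num.sqrt (enorm (lsubmx p - x0) ^+ 2 + eps ^+ 2) ->
  A p -> rsubmx p != u ->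
  (forall q, A q -> penalty x0 u lam eps p <= penalty x0 u lam eps q) ->
  frechet_normal A p
    (row_mx (- (lam * enorm (rsubmx p - u) / b) *: (lsubmx p - x0))
            (- (rsubmx p - u))).
Proof.
move=> lam0 eps0 bE Ap; rewrite -subr_eq0 => /enorm_gt0.
rewrite /penalty -bE; move: bE; set h := rsubmx p - u; set xi := lsubmx p - x0.
set a := enorm h => bE a0 pmin.
have b2 : b ^+ 2 = dot xi xi + eps ^+ 2.
  rewrite bE sqr_sqrtr; first by rewrite sqr_enorm.
  by apply: addr_ge0; exact: sqr_ge0.
have b0 : 0 < b by rewrite bE sqrtr_gt0; apply: ltr_wpDl; rewrite ?sqr_ge0 // exprn_gt0.
set c := lam * a / b.
have c0 : 0 <= c by apply: divr_ge0; [apply: mulr_ge0|]; rewrite // ltW.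
suff quad q : A q -> dot (row_mx (- c *: xi) (- h)) (q - p)
    <= (1 + c) / 2 * enorm (q - p) ^+ 2.
  exact: (frechet_normal_quadratic quad).
move=> Aq.
have := pmin q Aq; set a' := enorm (rsubmx q - u); set b' := Num.sqrt _ => le_ab.
set dx := lsubmx q - lsubmx p; set dv := rsubmx q - rsubmx p.
have a'2 : a' ^+ 2 = a ^+ 2 + 2 * dot h dv + dot dv dv.
  have -> : a' = enorm (h + dv) by rewrite [h + dv]addrC subrKA.
  by rewrite sqr_enormD sqr_enorm.
have b'2 : b' ^+ 2 = b ^+ 2 + 2 * dot xi dx + dot dx dx.
  rewrite sqr_sqrtr; last by apply: addr_ge0; exact: sqr_ge0.
  rewrite b2.
  have -> : lsubmx q - x0 = xi + dx by rewrite [RHS]addrC subrKA.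
  by rewrite sqr_enormD; ring.
have lE : lsubmx (q - p) = dx by rewrite linearB.
have rE : rsubmx (q - p) = dv by rewrite linearB.
have -> : dot (row_mx (- c *: xi) (- h)) (q - p) = - (c * dot xi dx) - dot h dv.
  by rewrite dot_row_mx lE rE dotZl dotNl mulNr.
have -> : enorm (q - p) ^+ 2 = dot dx dx + dot dv dv.
  by rewrite sqr_enorm -[X in dot X _]hsubmxK dot_row_mx lE rE.
(* The inequality [2 * a * a' <= a ^+ 2 + a' ^+ 2] replaces the norms by their squares, whose
   expansions are exact. *)
have aa' : a * a' <= a ^+ 2 + dot h dv + dot dv dv / 2.
  have := sqr_ge0 (a - a'); rewrite sqrrB a'2 -mulr_natr; lra.
have bb' : b * b' <= b ^+ 2 + dot xi dx + dot dx dx / 2.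
  have := sqr_ge0 (b - b'); rewrite sqrrB b'2 -mulr_natr; lra.
have cb : c * b = lam * a by rewrite divfK // gt_eqF.
(* Minimality multiplied by [a], with [lam * a] rewritten as [c * b]. *)
have le1 : a ^+ 2 + c * b ^+ 2 <= a * a' + c * (b * b').
  have := ler_wpM2l (ltW a0) le_ab.
  have -> : a * (a' + lam * b') = a * a' + c * b * b' by rewrite cb; ring.
  have -> : a * (a + lam * b) = a ^+ 2 + c * b * b by rewrite cb; ring.
  lra.
have := ler_wpM2l c0 bb'.
have := dot_ge0 dv; have := dot_ge0 dx.
have := mulr_ge0 c0 (dot_ge0 dv).
lra.
Qed.

(** This form avoids differences of extended reals and tests only points of finite value, which
    suits passage to the limit in [x] and [v]. *)
Lemma subdiffP n (f : 'rV[R]_n -> \bar R) x v : proper_fun f ->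
  subdiff f x v <->
  forall y b, f y = b%:E -> (f x <= (b - dot v (y - x))%:E)%E.
Proof.
move=> [f_gtNy [y0 fy0]]; split.
  move=> [fx fv] y b fy; have := fv y; rewrite fy.
  case: (f x) (f_gtNy x) fx => [a| |] // _ _.
  by rewrite -EFinB !lee_fin; lra.
move=> fv.
have fx : (f x < +oo)%E.
  case fyE : (f y0) (f_gtNy y0) fy0 => [b| |] // _ _.
  exact: le_lt_trans (fv _ _ fyE) (ltry _).
split => // y.
case fyE : (f y) (f_gtNy y) => [b| |] // _.
  have := fv _ _ fyE; case: (f x) (f_gtNy x) fx => [a| |] // _ _.
  by rewrite -EFinB !lee_fin; lra.
by case: (f x) (f_gtNy x) fx => [a| |] // _ _; rewrite leey.
Qed.

(** A strict failure of the subgradient inequality persists at nearby pairs, by lower semicontinuity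
    of [f] and continuity of [dot]; the real [c] separates the two sides. *)
Lemma closed_gph_subdiff n (f : 'rV[R]_n -> \bar R) :
  proper_fun f -> lower_semicontinuous f -> closed (gph_subdiff f).
Proof.
move=> f_proper f_lsc p clp; apply/subdiffP => // y b fy.
rewrite leNgt; apply/negP => lt_fx.
have [c lt_c c_lt] : exists2 c, b - dot (rsubmx p) (y - lsubmx p) < c
    & (c%:E < f (lsubmx p))%E.
  case: (f (lsubmx p)) lt_fx => [a| |] //.
    rewrite lte_fin => ab.
    by have [l r] := midf_lt ab; exists ((b - dot (rsubmx p) (y - lsubmx p) + a) / 2).
  by move=> _; exists (b - dot (rsubmx p) (y - lsubmx p) + 1); rewrite ?ltry ?ltrDl.
have [V Vx Vlt] := f_lsc _ _ c_lt.
have dotc : continuous (fun q : 'rV[R]_(n + n) =>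
    dot (rsubmx q) (y - lsubmx q)).
  apply: continuous_dot => i; first exact: continuous_coord_rsubmx.
  apply: continuous_coordB => [z|]; first exact: cst_continuous.
  exact: continuous_coord_lsubmx.
have bc : b - c < dot (rsubmx p) (y - lsubmx p) by rewrite ltrBlDl -ltrBlDr.
have Glt := @cvgr_gt _ _ _ (nbhs_filter p) _ _ (dotc p) _ bc.
have [q [Aq [Vq qc]]] := 
  clp _ (@filterI _ _ (nbhs_filter p) _ _ (continuous_lsubmx Vx) Glt).
move: Aq => /(subdiffP _ _ f_proper)/(_ y b fy).
have := Vlt _ Vq => cq.
by rewrite leNgt (lt_trans _ cq) // lte_fin ltrBlDr -ltrBlDl.
Qed.

(** One [t] of the final [2 * t] bounds the move from [x0] to the minimiser, the other the distance
    from there to the inverse image of [u]. The bounds involving [r] keep the minimiser and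
    [h = v - u] in the balls of the growth condition. *)
Lemma subdiff_inv_near n (psi : R -> R) (f : 'rV[R]_n -> \bar R)
    (xbar x0 v0 u : 'rV[R]_n) (kappa r t : R) :
  admissible psi -> convex_on_nonneg psi ->
  proper_fun f -> lower_semicontinuous f -> 0 < kappa ->
  (forall x v h : 'rV[R]_n, subdiff f x v ->
     eball xbar r x -> eball 0 r v -> eball 0 r h ->
     forall z : 'rV[R]_n, second_subdiff f x v h z ->
       ((kappa * enorm h ^+ 2)%:E * eta_psi psi f x v h <= (dot z h)%:E)%E) ->
  subdiff f x0 v0 -> 0 < t -> enorm (x0 - xbar) + t <= r ->
  enorm (v0 - u) < kappa * psi t -> enorm (v0 - u) < r / 2 -> enorm u < r / 2 ->
  exists2 y, subdiff f y u & enorm (y - x0) < 2 * t.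
Proof.
move=> psi_adm psi_convex f_proper f_lsc kappa0 growth x0v0 t0 x0r v0u v0r ur.
set a0 := enorm (v0 - u) in v0u v0r.
have a0_ge0 : 0 <= a0 := enorm_ge0 _.
(* [lam * t] is the midpoint of [a0] and [kappa * psi t]: above [a0] to keep the minimiser within
   [t] of [x0], below [kappa * psi t] for the final contradiction. *)
pose lam := (a0 + kappa * psi t) / 2 / t.
have lamt : lam * t = (a0 + kappa * psi t) / 2 by rewrite divfK // gt_eqF.
have a0lam : a0 < lam * t by rewrite lamt; lra.
have lamlt : lam * t < kappa * psi t by rewrite lamt; lra.
have lam0 : 0 < lam by rewrite -(pmulr_lgt0 _ t0); apply: le_lt_trans a0lam.
(* The smoothing is so small that the initial penalty [a0 + lam * eps] stays below both [lam * t]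
   and [r / 2]. *)
pose eps := (Num.min (lam * t) (r / 2) - a0) / 2 / lam.
have lameps : lam * eps = (Num.min (lam * t) (r / 2) - a0) / 2.
  by rewrite mulrC divfK // gt_eqF.
have minD : 0 < Num.min (lam * t) (r / 2) - a0.
  by rewrite subr_gt0 lt_min a0lam.
have eps0 : 0 < eps by rewrite -(pmulr_rgt0 _ lam0) lameps divr_gt0.
have min1 : Num.min (lam * t) (r / 2) <= lam * t by rewrite ge_min lexx.
have min2 : Num.min (lam * t) (r / 2) <= r / 2 by rewrite ge_min lexx orbT.
have Fp0 : penalty x0 u lam eps (row_mx x0 v0) = a0 + lam * eps.
  rewrite /penalty row_mxKl row_mxKr subrr enorm0 expr0n add0r sqrtr_sqr.
  by rewrite gtr0_norm.
have [||||p Ap pmin] := @closed_argmin R _ (gph_subdiff f)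
  (penalty x0 u lam eps) (row_mx x0 v0).
- exact: closed_gph_subdiff.
- exact: continuous_penalty.
- by rewrite /gph_subdiff /= row_mxKl row_mxKr.
- exists (enorm u + enorm x0 + (a0 + lam * eps) + lam^-1 * (a0 + lam * eps)).
  rewrite Fp0 => q qle; apply: le_trans (norm_le_penalty x0 u eps q lam0) _.
  have := ler_wpM2l (_ : 0 <= lam^-1) qle; rewrite invr_ge0 ltW // => /(_ isT).
  lra.
have := pmin (row_mx x0 v0); rewrite {1}/gph_subdiff /= row_mxKl row_mxKr.
move=> /(_ x0v0); rewrite Fp0 {1}/penalty.
set b := Num.sqrt _; set x := lsubmx p; set v := rsubmx p => le_ab.
have xv : subdiff f x v := Ap.
have xb : enorm (x - x0) <= b.
  rewrite -[leLHS]ger0_norm ?enorm_ge0 // -sqrtr_sqr ler_wsqrtr //.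
  by rewrite lerDl sqr_ge0.
have b0 : 0 < b.
  by rewrite sqrtr_gt0; apply: ltr_wpDl; rewrite ?sqr_ge0 // exprn_gt0.
have lamx := ler_wpM2l (ltW lam0) xb.
have a_ge0 := enorm_ge0 (v - u).
have xt : enorm (x - x0) < t by rewrite -(ltr_pM2l lam0); lra.
have xx0_ge0 := mulr_ge0 (ltW lam0) (enorm_ge0 (x - x0)).
have [vu|vNu] := eqVneq v u.
  by exists x; [rewrite -vu|apply: lt_trans xt _; lra].
have a_gt0 : 0 < enorm (v - u) by rewrite enorm_gt0 // subr_eq0.
pose z := - (lam * enorm (v - u) / b) *: (x - x0).
(* A Fréchet normal is a limiting normal through constant sequences. *)
have zP : second_subdiff f x v (v - u) z.
  exists (fun=> p), (fun=> row_mx z (- (v - u))); split => //.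
  - by move=> _; apply: penalty_normal pmin => //; exact: ltW.
  - by rewrite hsubmxK; exact: cvg_cst.
  - exact: cvg_cst.
have := growth x v (v - u) xv; rewrite /eball /= !subr0.
have -> : enorm (x - xbar) < r.
  have : enorm (x - xbar) <= enorm (x - x0) + enorm (x0 - xbar).
    by rewrite -[x - xbar](subrKA x0) enormD.
  lra.
have -> : enorm v < r.
  by have := enormD (v - u) u; rewrite subrK; lra.
have -> : enorm (v - u) < r by lra.
move=> /(_ isT isT isT z zP).
(* Since [enorm (x - x0) <= b], the norm of [z] is at most [lam * enorm (v - u)]. *)
have zh : dot z (v - u) <= lam * enorm (v - u) ^+ 2.
  apply: le_trans (dot_le_enorm _ _) _.
  rewrite /z enormZ normrN ger0_norm; last first.
    by apply: divr_ge0; [apply: mulr_ge0|]; rewrite // ltW.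
  rewrite [leRHS]mulrA ler_wpM2r // mulrAC ler_pdivrMr //.
  by apply: ler_wpM2l => //; apply: mulr_ge0; rewrite // ltW.
(* With [h = v - u] the inverse image is taken at [v - h = u]. A distance below [t] finishes by the
   triangle inequality; otherwise [kappa * (psi t / t) <= lam], against [lamlt]. *)
rewrite /eta_psi subKr; have [dt _|td] := ltP (dist_set x (subdiff_inv f u)) t%:E.
  have [_ [y uy <-]] := ereal_inf_lt dt; rewrite lte_fin => xy; exists y => //.
  rewrite -(subrKA x) (le_lt_trans (enormD _ _)) // enorm_dist.
  lra.
have := slope_le_extend_pinfty psi_adm psi_convex t0 td.
set eta := extend_pinfty _ _ => eta_ge le_zh.
have k0 : 0 < kappa * enorm (v - u) ^+ 2 by rewrite mulr_gt0 // exprn_gt0.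
have : ((kappa * enorm (v - u) ^+ 2)%:E * (psi t / t)%:E
        <= (lam * enorm (v - u) ^+ 2)%:E)%E.
  apply: le_trans (lee_wpmul2l _ eta_ge) _; first by rewrite lee_fin ltW.
  by apply: le_trans le_zh _; rewrite lee_fin.
rewrite -EFinM lee_fin mulrAC ler_pM2r ?exprn_gt0 //.
by rewrite mulrA ler_pdivrMr // leNgt lamlt.
Qed.

End Regularity.

(** * From solvability near a pair to well-posedness *)

Theorem corollary6p2 (R : realType) (n : nat) (psi : R -> R)
    (f : 'rV[R]_n -> \bar R) (xbar : 'rV[R]_n)
    (psi_adm : admissible psi) (psi_convex : convex_on_nonneg psi)
    (f_proper : proper_fun f) (f_lsc : lower_semicontinuous f)
    (f_convex : convex_efun f)
    (xbar_min : forall x, (f xbar <= f x)%E)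
    (growth : exists kappa r : R, [/\ 0 < kappa, 0 < r &
       forall x v h : 'rV[R]_n, subdiff f x v ->
         eball xbar r x -> eball 0 r v -> eball 0 r h ->
         forall z : 'rV[R]_n, second_subdiff f x v h z ->
           ((kappa * enorm h ^+ 2)%:E * eta_psi psi f x v h <= (dot z h)%:E)%E]) :
  SLWP (fun t : R => \int[lebesgue_measure]_(s in `[0, t]) psi s) f xbar.
Proof.
have [f_gtNy [y0 fy0]] := f_proper.
have xbar_fin : (f xbar < +oo)%E := le_lt_trans (xbar_min y0) fy0.
split=> //; have [kappa [r [kappa0 r0 growthP]]] := growth.
have near := @subdiff_inv_near _ _ _ _ xbar _ _ _ kappa r _
  psi_adm psi_convex f_proper f_lsc kappa0 growthP.
have [psi_ge0 psi_homo psi0 _] := psi_adm.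
have xbar0 : subdiff f xbar 0.
  split=> // y; rewrite -(scale0r 0) dotZl mul0r sube_ge0 ?xbar_min //.
  by rewrite fin_numE; case: (f xbar) (f_gtNy xbar) xbar_fin.
(* The last bound will make the perturbation [w] shorter than [r / 4]; it is reached because [psi]
   is at most linear on [[0, 1]]. *)
have [r' [r'0 r'r r'psi]] : exists r' : R,
    [/\ 0 < r', r' <= r / 2 & kappa * psi (r' / 2) < r / 2].
  have M0 : 0 < kappa * psi 1 + 1 by rewrite ltr_wpDl // mulr_ge0 ?psi_ge0 // ltW.
  exists (Num.min 1 (Num.min (r / 2) (r / 2 / (kappa * psi 1 + 1)))).
  set r' := Num.min _ _.
  have r'0 : 0 < r' by rewrite !lt_min ltr01 !divr_gt0.
  have r'1 : r' <= 1 by rewrite ge_min lexx.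
  have r'M : r' * (kappa * psi 1 + 1) <= r / 2.
    by rewrite -ler_pdivlMr // !ge_min lexx !orbT.
  split=> //; first by rewrite !ge_min lexx orbT.
  have h0 : 0 <= r' / 2 by lra.
  have h1 : r' / 2 <= 1 by lra.
  have := psi_le_mul psi_adm psi_convex h0 h1.
  have := psi_ge0 1 ler01.
  move=> p1 /(ler_wpM2l (ltW kappa0)).
  have := mulr_ge0 (ltW r'0) (mulr_ge0 (ltW kappa0) p1).
  lra.
(* The second bound puts a solution within [r' / 2] of [xbar]; the first leaves room for [u + w] to
   stay shorter than [r / 2]. *)
pose delta := Num.min (r / 4) (kappa * psi (r' / 4)).
have d0 : 0 < delta.
  by rewrite lt_min divr_gt0 //= mulr_gt0 // psi_gt0 // divr_gt0.
exists delta, r', kappa^-1, (4^-1); split=> //; first by rewrite invr_gt0.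
have sol u : eball 0 delta u -> exists y, subdiff f y u /\ ecball xbar r' y.
  rewrite /eball /ecball /= subr0 lt_min => /andP[ur upsi].
  have [|||||y uy yr] := near xbar 0 u (r' / 4) xbar0.
  - by rewrite divr_gt0.
  - by rewrite subrr enorm0; lra.
  - by rewrite sub0r enormN.
  - by rewrite sub0r enormN; lra.
  - lra.
  by exists y; split=> //; lra.
pose sol_at u y := subdiff f y u /\ ecball xbar r' y.
(* The inverse image at 0 may contain other minimisers, so the value at 0 is imposed. *)
pose xs u := if u == 0 then xbar else xget xbar [set y | sol_at u y].
have xsP u : eball 0 delta u -> sol_at u (xs u).
  move=> /sol[y uy]; rewrite /xs; case: eqP => [->|_]; last first.
    exact: (@xgetPex _ xbar [set y | sol_at u y] (ex_intro _ y uy)).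
  by split=> //; rewrite /ecball /= subrr enorm0 ltW.
exists xs; split; first by rewrite /xs eqxx.
move=> u ud; have [uxs xsr'] := xsP u ud; split=> // x xr'.
move: (xs u) uxs xsr' => y uy yr'.
have [fy uyP] := uy.
move: ud; rewrite /eball /= subr0 lt_min => /andP[ur _].
rewrite /ecball /= in xr' yr'.
case fyE : (f y) (f_gtNy y) fy => [a| |] // _ _.
case fxE : (f x) (f_gtNy x) => [b| |] // _; last first.
  rewrite /tilt fxE fyE /=.
  by rewrite mulry gtr0_sg ?invr_gt0 // mul1e leey.
rewrite /tilt fxE fyE -!EFinB -EFinM lee_fin ler_pdivlMl //.
have [xy|xy] := eqVneq x y.
  have -> : b = a by move: fxE; rewrite xy fyE => -[].
  rewrite xy !subrr enorm0 mulr0.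
  rewrite pmulr_rle0 //.
  by have := Rintegral_le_mul psi_adm (lexx 0); rewrite mul0r.
have D0 : 0 < enorm (x - y) by rewrite enorm_gt0 // subr_eq0.
set D := enorm (x - y) in D0 *.
have D2 : D <= 2 * r'.
  have : D <= enorm (x - xbar) + enorm (xbar - y).
    by rewrite /D -(subrKA xbar) enormD.
  by rewrite (enorm_dist xbar); lra.
have D4 : 0 < D / 4 by lra.
have psiD : psi (D / 4) <= psi (r' / 2) by apply: psi_homo; lra.
have psiD0 := psi_gt0 psi_adm D4.
(* The half makes [enorm w = s] strictly less than [kappa * psi (D / 4)], as [near] demands. *)
pose s := kappa * psi (D / 4) / 2.
have s0 : 0 < s by rewrite divr_gt0 // mulr_gt0.
have s4 : s < r / 4.
  by have := ler_wpM2l (ltW kappa0) psiD; rewrite /s; lra.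
pose w := (s / D) *: (x - y).
have ws : enorm w = s.
  rewrite enormZ -/D ger0_norm; last by apply: divr_ge0; exact: ltW.
  by rewrite divfK // gt_eqF.
have wxy : dot w (x - y) = s * D.
  by rewrite /w dotZl -sqr_enorm -/D; field; rewrite gt_eqF.
(* The start is now the pair [(y, u)]; [enorm (y - xbar) + D / 4] is at most [r' + r' / 2], hence at
   most [r]. *)
have [|||||x' ux' x'y] := near y u (u + w) (D / 4) uy.
- by [].
- lra.
- by rewrite opprD addNKr enormN ws /s; have := mulr_gt0 kappa0 psiD0; lra.
- by rewrite opprD addNKr enormN ws; lra.
- by have := enormD u w; rewrite ws; lra.
have := (subdiffP _ _ f_proper).1 ux' _ _ fxE.
have := uyP x'; rewrite fyE.
have [fx' _] := ux'.
case: (f x') (f_gtNy x') fx' => [c| |] // _ _.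
rewrite -EFinB !lee_fin => le1 le2.
have wx' : dot w (x' - y) <= s * (D / 2).
  apply: le_trans (dot_le_enorm _ _) _; rewrite ws ler_wpM2l ?ltW //; lra.
have phiD := Rintegral_le_mul psi_adm (ltW D4).
have := ler_wpM2l (ltW kappa0) phiD.
(* The sum of [le1] and [le2] bounds the growth below by [dot w (x - x')], at least [s * D / 2 =
   kappa * (D / 4 * psi (D / 4))]; hence the constants [kappa^-1] and [4^-1]. *)
move: le1 le2 wx' wxy; rewrite !dotE /s -/D [4^-1 * D]mulrC; lra.
Qed.
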